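(* Let $A$ be a metrizable abelian topological group. Then $\hat A$ is a $k$-space.
   Context: $\mathbb{T}=\mathbb{R}/\mathbb{Z}$. $\hat A$ is the group of continuous homomorphisms $A\to\mathbb{T}$ with the compact-open topology. A Hausdorff space $X$ is a $k$-space if a subset $F\subseteq X$ is closed whenever $F\cap K$ is closed in $K$ for every compact $K\subseteq X$. *)

(* Defs.v *)
From HB Require Import structures.
From mathcomp Require Import all_boot all_order all_algebra generic_quotient.
From mathcomp Require Import all_classical all_reals all_analysis.
Set Implicit Arguments. Unset Strict Implicit. Unset Printing Implicit Defensive.
Import Order.TTheory GRing.Theory Num.Theory numFieldTopology.Exports.
Local Open Scope classical_set_scope.
Local Open Scope ring_scope.
Local Open Scope quotient_scope.

Definition modZ (R : realType) : rel R := fun x y => (x - y) \is a Num.int.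

Lemma modZ_refl (R : realType) : reflexive (@modZ R).
Proof. by move=> x; rewrite /modZ subrr rpred0. Qed.

Lemma modZ_sym (R : realType) : symmetric (@modZ R).
Proof. by move=> x y; rewrite /modZ -opprB rpredN. Qed.

Lemma modZ_trans (R : realType) : transitive (@modZ R).
Proof.
move=> y x z Hxy Hyz; rewrite /modZ.
by rewrite -[x - z](subrKA y) rpredD.
Qed.

Definition modZ_equiv (R : realType) : equiv_rel R :=
  EquivRel (@modZ R) (@modZ_refl R) (@modZ_sym R) (@modZ_trans R).

Definition circle (R : realType) : Type :=
  quotient_topology {eq_quot (modZ_equiv R)}.
HB.instance Definition _ (R : realType) :=
  Quotient.copy (circle R) (quotient_topology {eq_quot (modZ_equiv R)}).
HB.instance Definition _ (R : realType) :=
  Topological.copy (circle R) (quotient_topology {eq_quot (modZ_equiv R)}).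

Definition circle_add (R : realType) (a b : circle R) : circle R :=
  \pi_(circle R) (repr a + repr b).

Definition metrizable (R : realType) (X : topologicalType) : Prop :=
  exists d : X -> X -> R,
    [/\ forall x y, 0 <= d x y,
        forall x y, d x y = 0 <-> x = y,
        forall x y, d x y = d y x,
        forall x y z, d x z <= d x y + d y z &
        forall (x : X) (U : set X),
          nbhs x U <-> exists2 e : R, 0 < e & [set y | d x y < e] `<=` U].

Definition dual_set (R : realType) (A : topologicalZmodType) :
    set {compact-open, A -> circle R} :=
  [set f | continuous (f : A -> circle R) /\
           forall x y : A, f (x + y) = circle_add (f x) (f y)].

Definition dual (R : realType) (A : topologicalZmodType) : Type :=
  set_type (@dual_set R A).
HB.instance Definition _ (R : realType) (A : topologicalZmodType) :=
  Topological.copy (dual R A) (set_type (@dual_set R A)).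

Definition k_space (X : topologicalType) : Prop :=
  hausdorff_space X /\
  forall F : set X,
    (forall K : set X, compact K ->
       closed ((@set_val X K) @^-1` F : set (set_type K))) ->
    closed F.

(* Main.v *)
(** The argument is of Banach-Dieudonne type.  Call polar of [S] the set of
    characters within [1/4] of a fixed character [f] on [S].  The circle has no
    nontrivial subgroup within [1/4] of [0], so the polar of the whole group is
    [{f}]; the quantitative form of this fact makes the polar of a neighbourhood
    of [0] equicontinuous, hence compact by Arzela-Ascoli.  Let [F] have closed
    traces on compact sets and miss [f], and let [U n] be a decreasing base of
    neighbourhoods of [0] with [U 0] the whole group.  Compactness yields finite
    sets [E n `<=` U n] such that, for every [n], the polar of the union of
    [U n] and the [E i] with [i < n] misses [F].  The points of the [E n]
    converge to [0], so together with [0] they form a compact set [K], whose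
    polar is a neighbourhood of [f].  Every character lies in the polar of some
    [U n], hence the polar of [K] misses [F]. *)

Require Import Defs.
From HB Require Import structures.
From mathcomp Require Import all_boot all_order all_algebra generic_quotient.
From mathcomp Require Import all_classical all_reals all_analysis.
From mathcomp Require Import finmap lra.
Set Implicit Arguments. Unset Strict Implicit. Unset Printing Implicit Defensive.
Import Order.TTheory GRing.Theory Num.Theory numFieldTopology.Exports.
Local Open Scope classical_set_scope.
Local Open Scope ring_scope.
Local Open Scope quotient_scope.

Section DistanceToIntegers.
Variable R : realType.
Implicit Types s t : R.

Definition distZ t : R := `|t - (Num.floor (t + 2^-1))%:~R|.

Lemma distZ_ge0 t : 0 <= distZ t.
Proof. exact: normr_ge0. Qed.

Lemma distZ_le_half t : distZ t <= 2^-1.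
Proof.
have := floor_itv (t + 2^-1); rewrite intrD => /andP[? ?].
by rewrite ler_norml; apply/andP; split; lra.
Qed.

Lemma nearest_int_le t (m n : int) :
  `|t - m%:~R| <= 2^-1 -> `|t - m%:~R| <= `|t - n%:~R|.
Proof.
move=> tm; have [->//|mn] := eqVneq m n.
have mn_ge1 : 1 <= `|m%:~R - n%:~R| :> R.
  by rewrite -intrB -intr_norm ler1z -gtz0_ge1 normr_gt0 subr_eq0.
by have := ler_distD t m%:~R (n%:~R : R); rewrite (distrC m%:~R t); lra.
Qed.

Lemma distZ_le t (m : int) : distZ t <= `|t - m%:~R|.
Proof. exact/nearest_int_le/distZ_le_half. Qed.

Lemma distZ_eq t (m : int) : `|t - m%:~R| <= 2^-1 -> distZ t = `|t - m%:~R|.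
Proof. by move=> tm; apply/le_anti; rewrite distZ_le nearest_int_le. Qed.

Lemma distZ_attained t : exists m : int, distZ t = `|t - m%:~R|.
Proof. by exists (Num.floor (t + 2^-1)). Qed.

Lemma distZ_le_norm t : distZ t <= `|t|.
Proof. by have := distZ_le t 0; rewrite subr0. Qed.

Lemma distZ0 : distZ 0 = 0.
Proof. by apply/le_anti; rewrite distZ_ge0 -{2}(normr0 R) distZ_le_norm. Qed.

Lemma distZD s t : distZ (s + t) <= distZ s + distZ t.
Proof.
have [m ->] := distZ_attained s; have [n ->] := distZ_attained t.
apply: le_trans (distZ_le _ (m + n)) (le_trans _ (ler_normD _ _)).
by rewrite intrD opprD addrACA.
Qed.

Lemma distZN t : distZ (- t) = distZ t.
Proof.
have distZN_le u : distZ (- u) <= distZ u.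
  have [m ->] := distZ_attained u; apply: le_trans (distZ_le _ (- m)) _.
  by rewrite mulrNz -opprD normrN.
by apply/le_anti; rewrite distZN_le -{1}(opprK t) distZN_le.
Qed.

Lemma distZ_eq0P t : reflect (distZ t = 0) (t \is a Num.int).
Proof.
apply: (iffP idP) => [/intrP[m ->]|/eqP]; last first.
  by rewrite normr_eq0 subr_eq0 => /eqP ->; exact: intr_int.
apply/le_anti; rewrite distZ_ge0 andbT.
by have := distZ_le m%:~R m; rewrite subrr normr0.
Qed.

Lemma distZ_modZ s t : modZ s t -> distZ s = distZ t.
Proof.
have distZ_modZ_le u v : modZ u v -> distZ u <= distZ v.
  by move=> /distZ_eq0P uv; have := distZD (u - v) v; rewrite subrK uv add0r.
by move=> st; apply/le_anti; rewrite !distZ_modZ_le // modZ_sym.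
Qed.

Lemma distZ_mul2n t : distZ t <= 4^-1 -> distZ (t *+ 2) = distZ t *+ 2.
Proof.
have [m ->] := distZ_attained t => tm.
have double_dist : `|t *+ 2 - (m *+ 2)%:~R| = `|t - m%:~R| *+ 2.
  by rewrite -normrMn mulrnBl raddfMn.
by rewrite (@distZ_eq _ (m *+ 2)) double_dist //; lra.
Qed.

Lemma distZ_continuous : continuous distZ.
Proof.
have distZ_lip s t : distZ s - distZ t <= `|s - t|.
  rewrite lerBlDr -{1}(subrK t s) (le_trans (distZD _ _)) //.
  by rewrite lerD2r distZ_le_norm.
move=> t; apply/cvgrPdist_lt => e e0; near=> s.
apply: (@le_lt_trans _ _ `|t - s|).
  by rewrite ler_norml distZ_lip lerNl opprB distrC distZ_lip.
by near: s; exact: cvgr_dist_lt.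
Unshelve. all: by end_near. Qed.

End DistanceToIntegers.

Section CircleGroup.
Variable R : realType.
Implicit Types a b : circle R.

Lemma pi_circle_eqP (x y : R) :
  reflect (\pi_(circle R) x = \pi_(circle R) y) (modZ x y).
Proof. exact: (@eqmodP _ (modZ_equiv R)). Qed.

Lemma repr_pi_circle (x : R) : modZ (repr (\pi_(circle R) x)) x.
Proof. by apply/pi_circle_eqP; rewrite reprK. Qed.

Lemma circle_add_pi (x y : R) :
  circle_add (\pi_(circle R) x) (\pi_(circle R) y) = \pi_(circle R) (x + y).
Proof.
apply/pi_circle_eqP; rewrite /modZ opprD addrACA.
by apply: rpredD; exact: repr_pi_circle.
Qed.

Definition circle_opp a : circle R := \pi_(circle R) (- repr a).

Lemma circle_opp_pi (x : R) :
  circle_opp (\pi_(circle R) x) = \pi_(circle R) (- x).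
Proof.
by apply/pi_circle_eqP; rewrite /modZ -opprD rpredN; exact: repr_pi_circle.
Qed.

Lemma circle_addA : associative (@circle_add R).
Proof.
move=> a b c; elim/quotW: a => x; elim/quotW: b => y; elim/quotW: c => z.
by rewrite (circle_add_pi x y) (circle_add_pi y z) !circle_add_pi addrA.
Qed.

Lemma circle_addC : commutative (@circle_add R).
Proof. by move=> a b; rewrite /circle_add addrC. Qed.

Lemma circle_add0 : left_id (\pi_(circle R) 0) (@circle_add R).
Proof. by move=> a; elim/quotW: a => x; rewrite circle_add_pi add0r. Qed.

Lemma circle_addN : left_inverse (\pi_(circle R) 0) circle_opp (@circle_add R).
Proof.
by move=> a; elim/quotW: a => x; rewrite circle_opp_pi circle_add_pi addNr.
Qed.

HB.instance Definition _ := GRing.isZmodule.Build (circle R)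
  circle_addA circle_addC circle_add0 circle_addN.

Lemma pi_circleD (x y : R) :
  \pi_(circle R) (x + y) = \pi_(circle R) x + \pi_(circle R) y.
Proof. exact/esym/circle_add_pi. Qed.

Lemma pi_circleN (x : R) : \pi_(circle R) (- x) = - \pi_(circle R) x.
Proof. exact/esym/circle_opp_pi. Qed.

Definition circle_norm a : R := distZ (repr a).

Lemma circle_norm_pi (x : R) : circle_norm (\pi_(circle R) x) = distZ x.
Proof. exact/distZ_modZ/repr_pi_circle. Qed.

Lemma circle_norm_piB (x y : R) :
  circle_norm (\pi_(circle R) x - \pi_(circle R) y) = distZ (x - y).
Proof. by rewrite -pi_circleN -pi_circleD circle_norm_pi. Qed.

Lemma circle_norm_ge0 a : 0 <= circle_norm a.
Proof. exact: distZ_ge0. Qed.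

Lemma circle_norm0 : circle_norm 0 = 0.
Proof. by rewrite circle_norm_pi distZ0. Qed.

Lemma circle_norm_eq0 a : circle_norm a = 0 -> a = 0.
Proof.
elim/quotW: a => x; rewrite circle_norm_pi => /distZ_eq0P x_int.
by apply/pi_circle_eqP; rewrite /modZ subr0.
Qed.

Lemma circle_normN a : circle_norm (- a) = circle_norm a.
Proof. by elim/quotW: a => x; rewrite -pi_circleN !circle_norm_pi distZN. Qed.

Lemma circle_normD a b : circle_norm (a + b) <= circle_norm a + circle_norm b.
Proof.
elim/quotW: a => x; elim/quotW: b => y.
by rewrite -pi_circleD !circle_norm_pi distZD.
Qed.

Lemma circle_distC a b : circle_norm (a - b) = circle_norm (b - a).
Proof. by rewrite -circle_normN opprB. Qed.

Lemma circle_norm_mul2n a :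
  circle_norm a <= 4^-1 -> circle_norm (a *+ 2) = circle_norm a *+ 2.
Proof.
elim/quotW: a => x; rewrite circle_norm_pi mulr2n -pi_circleD circle_norm_pi.
exact: distZ_mul2n.
Qed.

Lemma circle_norm_mul2Xn a k :
  (forall i, (i < k)%N -> circle_norm (a *+ (2 ^ i)) <= 4^-1) ->
  circle_norm (a *+ (2 ^ k)) = circle_norm a *+ (2 ^ k).
Proof.
elim: k => [|k IHk] small; first by rewrite expn0 !mulr1n.
rewrite expnSr !mulrnA circle_norm_mul2n; last exact: small.
by rewrite IHk // => i ik; apply: small; exact: leqW.
Qed.

Lemma circle_norm_lt_mul2Xn a (e : R) k : 4^-1 < e *+ (2 ^ k) ->
  (forall i, (i <= k)%N -> circle_norm (a *+ (2 ^ i)) <= 4^-1) ->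
  circle_norm a < e.
Proof.
move=> lt_e small; have /ltr_pMn2r <- : (0 < 2 ^ k)%N by rewrite expn_gt0.
rewrite -circle_norm_mul2Xn => [|i /ltnW]; last exact: small.
exact: le_lt_trans (small k _) lt_e.
Qed.

Lemma circle_norm_continuous : continuous circle_norm.
Proof.
apply: repr_comp_continuous; first exact: distZ_continuous.
by move=> x y /eqP/pi_circle_eqP/distZ_modZ ->.
Qed.

End CircleGroup.

Section CircleTopology.
Variable R : realType.
Implicit Types a b c : circle R.

Definition circle_ball a (e : R) : set (circle R) :=
  [set b | circle_norm (a - b) < e].

Lemma circle_ball_center a e : 0 < e -> circle_ball a e a.
Proof. by move=> e0; rewrite /circle_ball /= subrr circle_norm0. Qed.

Lemma circle_ball_sym a b e : circle_ball a e b -> circle_ball b e a.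
Proof. by rewrite /circle_ball /= circle_distC. Qed.

Lemma circle_ball_triangle a b c e1 e2 :
  circle_ball a e1 b -> circle_ball b e2 c -> circle_ball a (e1 + e2) c.
Proof.
rewrite /circle_ball /= => ab bc; rewrite -(subrKA b).
exact: le_lt_trans (circle_normD _ _) (ltrD ab bc).
Qed.

Lemma circle_ball_open a e : open (circle_ball a e).
Proof.
elim/quotW: a => x; rewrite -[open _]/(open (\pi_(circle R) @^-1` _)).
have -> : \pi_(circle R) @^-1` circle_ball (\pi_(circle R) x) e =
    (fun y => distZ (x - y)) @^-1` [set r | r < e].
  by apply/funext => y; rewrite /circle_ball /= circle_norm_piB.
apply: open_comp; last exact: open_lt.
move=> y _; apply: (@continuous_comp _ _ _ (fun y => x - y) (@distZ R)).
  by apply: cvgB; [exact: cvg_cst | exact: cvg_id].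
exact: distZ_continuous.
Qed.

Lemma nbhs_circle_ballP a U :
  nbhs a U <-> exists2 e, 0 < e & circle_ball a e `<=` U.
Proof.
split=> [|[e e0 sub]]; last first.
  apply: filterS sub _; apply: open_nbhs_nbhs.
  by split; [exact: circle_ball_open | exact: circle_ball_center].
rewrite nbhsE => -[B [open_B Ba] BU].
have : nbhs (repr a) (\pi_(circle R) @^-1` B).
  by apply: open_nbhs_nbhs; split; [exact: open_B | rewrite /= reprK].
move=> /nbhs_ballP[e /= e0 ball_B]; exists e => // b; rewrite /circle_ball /=.
rewrite -{1}[a]reprK -{1}[b]reprK circle_norm_piB.
have [m ->] := distZ_attained (repr a - repr b) => ab; apply: BU.
have -> : b = \pi_(circle R) (repr b + m%:~R).
  rewrite -[LHS]reprK; apply/pi_circle_eqP.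
  by rewrite modZ_sym /modZ addrC addKr intr_int.
by apply: ball_B; rewrite /ball /= opprD addrA.
Qed.

Lemma nbhs_circleE : nbhs = nbhs_ (entourage_ circle_ball).
Proof.
rewrite predeq2E => a U; rewrite nbhs_circle_ballP; split=> [[e e0 sub]|].
  exists [set ab | circle_ball ab.1 e ab.2]; first by exists e.
  by move=> b /xsectionP/sub.
move=> [E [e e0 ball_E] sub]; exists e => // b ab.
exact/sub/xsectionP/ball_E.
Qed.

Lemma circle_entourage_filter : Filter (entourage_ circle_ball).
Proof.
apply: filter_from_filter; first by exists 1 => /=.
move=> e1 e2 /= e1_gt0 e2_gt0.
exists (Num.min e1 e2) => /=; first by rewrite lt_min e1_gt0.
by move=> ab; rewrite /circle_ball /= lt_min => /andP.
Qed.

Lemma circle_entourage_diagonal E : entourage_ circle_ball E -> diagonal `<=` E.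
Proof.
move=> [e e0 sub] ab /diagonalP ab_eq; apply: sub.
by rewrite /= ab_eq; exact: circle_ball_center.
Qed.

Lemma circle_entourage_inv E :
  entourage_ circle_ball E -> entourage_ circle_ball (E^-1)%relation.
Proof.
move=> [e e0 sub]; exists e => // -[a b] /circle_ball_sym.
exact: (sub (b, a)).
Qed.

Lemma circle_entourage_split_ex E : entourage_ circle_ball E ->
  exists2 E', entourage_ circle_ball E' & (E' \; E')%relation `<=` E.
Proof.
move=> [e e0 sub]; exists [set ab | circle_ball ab.1 (e / 2) ab.2].
  by exists (e / 2) => //=; rewrite divr_gt0.
move=> [a c] [b /= ab bc]; apply: sub => /=; rewrite [e]splitr.
exact: circle_ball_triangle ab bc.
Qed.

HB.instance Definition _ := isPointed.Build (circle R) 0.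

(* The factory [Nbhs_isPseudoMetric] would equip the circle with a second
   topology, not convertible to the quotient topology. *)
HB.instance Definition _ := @Nbhs_isUniform_mixin.Build (circle R)
  (entourage_ circle_ball) circle_entourage_filter circle_entourage_diagonal
  circle_entourage_inv circle_entourage_split_ex nbhs_circleE.
HB.instance Definition _ := @Uniform_isPseudoMetric.Build R (circle R)
  circle_ball circle_ball_center circle_ball_sym circle_ball_triangle erefl.

Lemma ball_circleE a e : ball a e = [set b | circle_norm (a - b) < e].
Proof. by []. Qed.

Definition circle_dist a b : R := circle_norm (a - b).

Lemma circle_dist_eq0 a b : circle_dist a b = 0 -> a = b.
Proof. by move/circle_norm_eq0/eqP; rewrite subr_eq0 => /eqP. Qed.

HB.instance Definition _ := @PseudoMetric_isMetric.Build R (circle R)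
  circle_dist (fun a b => circle_norm_ge0 (a - b)) circle_dist_eq0
  (fun _ _ => erefl).

Lemma circle_sub_continuous :
  continuous (fun ab : circle R * circle R => ab.1 - ab.2).
Proof.
move=> [a b] U /nbhs_ballP[e /= e0 sub].
exists (ball a (e / 2), ball b (e / 2)).
  by split; apply: nbhsx_ballx; rewrite divr_gt0.
move=> [c d] /= [ac bd]; apply: sub; rewrite ball_circleE /=.
have -> : a - b - (c - d) = (a - c) - (b - d) by rewrite !opprD !opprK addrACA.
rewrite [e]splitr; apply: le_lt_trans (circle_normD _ _) _.
by rewrite circle_normN ltrD.
Qed.

HB.instance Definition _ :=
  PreTopologicalNmodule_isTopologicalZmodule.Build (circle R)
    circle_sub_continuous.

Lemma circle_compact : compact [set: circle R].
Proof.
have -> : [set: circle R] = \pi_(circle R) @` `[0, 1].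
  apply/seteqP; split=> // a _.
  exists (repr a - (Num.floor (repr a))%:~R).
    have := floor_itv (repr a); rewrite intrD => /andP[? ?].
    by rewrite /= in_itv /=; apply/andP; split; lra.
  rewrite -[RHS]reprK; apply/pi_circle_eqP.
  by rewrite /modZ addrC addKr rpredN intr_int.
apply: continuous_compact; last exact: segment_compact.
exact/continuous_subspaceT/pi_continuous.
Qed.

End CircleTopology.

Section CompactSets.

Lemma compact_cover_compact (T : topologicalType) (K : set T) :
  compact K -> cover_compact K.
Proof.
move=> Kc; have [[t _]|/set0P/negP/negPn/eqP ->] := pselect (K !=set0).
  pose pT : ptopologicalType := HB.pack T (isPointed.Build T t).
  by move: Kc; rewrite -[compact K]/(compact (K : set pT)) compact_cover.
by move=> I D O _ _; exists fset0.
Qed.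

Definition compactly_closed (T : topologicalType) (F : set T) :=
  forall K : set T, compact K ->
    closed (@set_val T K @^-1` F : set (set_type K)).

Lemma compactly_closed_setI (T : topologicalType) (K F : set T) :
  compactly_closed F -> compact K -> compact (K `&` F).
Proof.
move=> F_closed Kc; have := F_closed K Kc; rewrite -openC => -[B open_B BF].
have -> : K `&` F = K `&` ~` B.
  apply/seteqP; split=> x [Kx xFB]; split=> //.
    move=> Bx; have : (@set_val T K @^-1` B) (SigSub (mem_set Kx)) by [].
    by rewrite BF; apply.
  apply: contrapT => nFx; apply: xFB.
  have : (~` (@set_val T K @^-1` F)) (SigSub (mem_set Kx)) by [].
  by rewrite -BF.
by apply: compact_closedI => //; rewrite closedC.
Qed.

Lemma finite_setD_nbhs_compact (T : topologicalType) (p : T) (K : set T) :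
  K p -> (forall V, nbhs p V -> finite_set (K `\` V)) -> compact K.
Proof.
move=> Kp Kfin; rewrite compact_ultra => F FU FK.
have [Fp|/existsNP[V /not_implyP[pV nFV]]] := pselect (F --> p).
  by exists p.
have FKV : F (K `\` V).
  by apply: filterI => //; case: (in_ultra_setVsetC V FU).
have := finite_compact (Kfin V pV); rewrite compact_ultra => /(_ F FU FKV).
by move=> [x [[Kx _] Fx]]; exists x.
Qed.

Lemma ultra_fmap (T U : Type) (f : T -> U) (F : set_system T) :
  UltraFilter F -> UltraFilter (f @ F).
Proof.
move=> FU; split=> [|G GP FG]; first exact: fmap_proper_filter.
apply/seteqP; split=> // V GV.
have [//|FnV] := in_ultra_setVsetC (f @^-1` V) FU.
have : G (V `&` ~` V) by apply: filterI => //; exact: FG.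
by rewrite setICr => /filter_not_empty.
Qed.

End CompactSets.

Section TopologicalGroups.

Lemma zmod_cvgB (T : Type) (F : set_system T) (B : topologicalZmodType)
    {FF : Filter F} (f g : T -> B) (a b : B) :
  f @ F --> a -> g @ F --> b -> (f x - g x) @[x --> F] --> a - b.
Proof.
apply: (@continuous2_cvg _ _ _ _ _ _ _ _ (fun x y : B => x - y)).
exact: (@sub_continuous B (a, b)).
Qed.

Lemma mulrn_continuous (A : topologicalZmodType) n :
  continuous (fun x : A => x *+ n).
Proof.
elim: n => [|n IHn] x; first exact: cvg_cst.
rewrite /continuous_at mulrS; under eq_cvg do rewrite mulrS.
apply: (@continuous2_cvg _ _ _ _ _ _ _ _ (fun x y : A => x + y)) (IHn x) => //.
exact: (@add_continuous A (x, x *+ n)).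
Qed.

Lemma zmod_morphism_closed (A : zmodType) (B : topologicalZmodType) :
  hausdorff_space B ->
  closed [set h : {ptws A -> B} | zmod_morphism (h : A -> B)].
Proof.
move=> hausdorff_B.
have -> : [set h : {ptws A -> B} | zmod_morphism (h : A -> B)] =
    \bigcap_xy (fun h : {ptws A -> B} =>
      h (xy.1 - xy.2) - (h xy.1 - h xy.2)) @^-1` [set 0].
  apply/seteqP; split=> h hE; first by move=> xy _ /=; rewrite hE subrr.
  by move=> x y; apply/eqP; rewrite -subr_eq0; apply/eqP/(hE (x, y)).
apply: closed_bigI => -[x y] _; apply: preimage_closed; last first.
  exact/accessible_closed_set1/hausdorff_accessible.
have eval_continuous x' : continuous (fun h : {ptws A -> B} => h x').
  exact: (@proj_continuous _ (fun=> B)).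
move=> h _; have FF : Filter (nbhs h) by exact: nbhs_filter.
exact: zmod_cvgB (eval_continuous _ _)
  (zmod_cvgB (eval_continuous _ _) (eval_continuous _ _)).
Qed.

End TopologicalGroups.

Section Characters.
Variables (R : realType) (A : topologicalZmodType).
Implicit Types f g : dual R A.

Definition char_fun f : A -> circle R := \val f.

Lemma char_fun_continuous f : continuous (char_fun f).
Proof. by have [] := set_valP f. Qed.

Lemma char_fun_is_zmod_morphism f : zmod_morphism (char_fun f).
Proof.
have char_funD x y : char_fun f (x + y) = char_fun f x + char_fun f y.
  by have [_] := set_valP f; apply.
by move=> x y; apply/eqP; rewrite eq_sym subr_eq -char_funD subrK.
Qed.

HB.instance Definition _ f :=
  GRing.isZmodMorphism.Build A (circle R) (char_fun f)
    (char_fun_is_zmod_morphism f).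

Lemma char_fun_inj : injective char_fun.
Proof. exact: val_inj. Qed.

Lemma continuous_zmod_morphism_char (h : A -> circle R) :
  continuous h -> zmod_morphism h -> exists g, char_fun g = h.
Proof.
move=> h_cont h_morph; suff h_dual : @dual_set R A h.
  by exists (SigSub (mem_set h_dual)).
pose ha : {additive A -> circle R} :=
  HB.pack h (GRing.isZmodMorphism.Build _ _ h h_morph).
by split=> // x y; exact: (raddfD ha).
Qed.

Lemma dual_cvgP (F : set_system (dual R A)) {FF : Filter F} g :
  F --> g <-> {family compact, char_fun @ F --> char_fun g}.
Proof.
rewrite -(compact_open_fam_compactP (@char_fun_continuous g) _).
split=> [Fg U|cvg_fun U].
  by move=> /(@initial_continuous _ _ (@set_val _ (@dual_set R A)) g) /Fg.
rewrite nbhsE /= => -[B [[C open_C <-] Cg] CU]; rewrite nbhs_simpl.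
by apply: filterS CU _; apply: cvg_fun; exact: open_nbhs_nbhs.
Qed.

Lemma char_fun_family_cvg g : {family compact, char_fun @ g --> char_fun g}.
Proof. by apply: (@dual_cvgP (nbhs g) _ g).1 => U. Qed.

Lemma char_fun_ptws_cvg g : {ptws, char_fun @ g --> char_fun g}.
Proof.
have FF : Filter (char_fun @ nbhs g) by apply: fmap_filter.
exact: pointwise_cvg_compact_family FF (@char_fun_family_cvg g).
Qed.

Lemma dual_hausdorff : hausdorff_space (dual R A).
Proof.
move=> f g fg; apply: char_fun_inj.
apply: (@hausdorff_product A (fun=> circle R)) => [x|U V].
  exact: (@metric_hausdorff R).
move=> /char_fun_ptws_cvg fU /char_fun_ptws_cvg gV.
by have [h [Uh Vh]] := fg _ _ fU gV; exists (char_fun h).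
Qed.

End Characters.

Lemma archi_lt_mul2Xn (R : archiRealFieldType) (c e : R) :
  0 < e -> exists k : nat, c < e *+ (2 ^ k).
Proof.
move=> e0; exists (Num.bound (c / e)).
by rewrite -[e *+ _]mulr_natl natrX -ltr_pdivrMr // upper_nthrootP.
Qed.

Section SmallImages.
Variables (R : realType) (A : topologicalZmodType).

Lemma additive_near0_small (U : set A) (e : R) : nbhs 0 U -> 0 < e ->
  \forall x \near 0, forall h : {additive A -> circle R},
    (forall y, U y -> circle_norm (h y) <= 4^-1) -> circle_norm (h x) < e.
Proof.
move=> U0 /(archi_lt_mul2Xn 4^-1)[k lt_e].
have : \forall x \near (0 : A), forall i : 'I_k.+1, U (x *+ (2 ^ i)).
  apply: filter_forall => i.
  by have := @mulrn_continuous A (2 ^ i) 0 U; rewrite mul0rn; exact.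
apply: filterS => x Ux h hU; apply: circle_norm_lt_mul2Xn lt_e _ => i ik.
by rewrite -raddfMn; exact/hU/(Ux (Ordinal (ik : (i < k.+1)%N))).
Qed.

Lemma additive_small_eq0 (h : {additive A -> circle R}) :
  (forall x, circle_norm (h x) <= 4^-1) -> forall x, h x = 0.
Proof.
move=> h_small x; apply/circle_norm_eq0/le_anti; rewrite circle_norm_ge0 andbT.
apply/ler_addgt0Pr => e /(archi_lt_mul2Xn 4^-1)[k lt_e]; rewrite add0r.
by apply/ltW/(circle_norm_lt_mul2Xn lt_e) => i _; rewrite -raddfMn.
Qed.

End SmallImages.

Section Polars.
Variables (R : realType) (A : topologicalZmodType).
Implicit Types (f g : dual R A) (S U V K : set A).

Definition polar f S : set (dual R A) :=
  [set g | forall x, S x -> circle_norm (char_fun g x - char_fun f x) <= 4^-1].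

Lemma polarU f S U : polar f (S `|` U) = polar f S `&` polar f U.
Proof.
apply/seteqP; split=> [g gSU|g [gS gU] x [/gS|/gU]//].
by split=> x xS; apply: gSU; [left|right].
Qed.

Lemma polar_setT f : polar f setT = [set f].
Proof.
apply/seteqP; split=> [g gf|_ ->] /=; last first.
  by move=> x _; rewrite subrr circle_norm0 invr_ge0.
apply/char_fun_inj/funext => x; apply/eqP; rewrite -subr_eq0; apply/eqP.
apply: (@additive_small_eq0 _ _ (char_fun g \- char_fun f)) => y.
exact: gf.
Qed.

Lemma char_near0_small f (e : R) : 0 < e ->
  \forall x \near 0, circle_norm (char_fun f x) < e.
Proof.
move=> e0; have : \forall x \near 0, ball (0 : circle R) e (char_fun f x).
  by apply: char_fun_continuous; rewrite raddf0; exact: nbhsx_ballx.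
by apply: filterS => x; rewrite ball_circleE /= sub0r circle_normN.
Qed.

Lemma char_in_polar_near0 f g : exists2 U, nbhs 0 U & polar f U g.
Proof.
have e8 : (0 : R) < 8^-1 by rewrite invr_gt0.
exists [set x | circle_norm (char_fun g x) < 8^-1 /\
                circle_norm (char_fun f x) < 8^-1].
  exact: filterI (char_near0_small g e8) (char_near0_small f e8).
move=> x [/= gx fx]; have := circle_normD (char_fun g x) (- char_fun f x).
by rewrite circle_normN; lra.
Qed.

Lemma polar_nbhs f K : compact K -> nbhs f (polar f K).
Proof.
move=> Kc; have e4 : (0 : R) < 4^-1 by rewrite invr_gt0.
have : \forall g \near f, forall x, K x ->
    ball (char_fun f x) 4^-1 (char_fun g x : circle R).
  have entourage4 := entourage_ball (circle R) (PosNum e4).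
  exact: char_fun_family_cvg (fam_nbhs _ entourage4 Kc).
apply: filterS => g gK x /gK.
by rewrite ball_circleE /= circle_distC => /ltW.
Qed.

(* Continuity is not required: for a neighbourhood [S] of [0] it follows from
   [polar_hom_equicontinuous]. *)
Definition polar_hom f S : set (A -> circle R) :=
  [set h | zmod_morphism h /\
    forall x, S x -> circle_norm (h x - char_fun f x) <= 4^-1].

Lemma polarE f S : polar f S = @char_fun R A @^-1` polar_hom f S.
Proof.
by apply/seteqP; split=> g; [split=> //; exact: raddfB | case].
Qed.

Lemma polar_hom_closed f S : closed (polar_hom f S : set {ptws A -> circle R}).
Proof.
have -> : polar_hom f S = [set h | zmod_morphism h] `&` \bigcap_(x in S)
    (fun h : {ptws A -> circle R} => circle_norm (h x - char_fun f x)) @^-1`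
      [set r | r <= 4^-1] by [].
apply: closedI; first exact/zmod_morphism_closed/(@metric_hausdorff R).
apply: closed_bigI => x _; apply: preimage_closed; last exact: closed_le.
move=> h _; have FF : Filter (nbhs h) by exact: nbhs_filter.
apply: (continuous_cvg _ (@circle_norm_continuous R _)).
exact: zmod_cvgB (@proj_continuous _ (fun=> circle R) x h) (cvg_cst _).
Qed.

Lemma polar_closed f S : closed (polar f S).
Proof.
rewrite polarE.
apply: (@preimage_closed _ {ptws A -> circle R}); last exact: polar_hom_closed.
by move=> g _; exact: char_fun_ptws_cvg.
Qed.

Lemma polar_hom_equicontinuous f U :
  nbhs 0 U -> equicontinuous (polar_hom f U) id.
Proof.
move=> U0 x E; rewrite -entourage_ballE => -[e /= e0 sub].
have e2 : 0 < e / 2 by rewrite divr_gt0.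
have sub_cvg0 : x - y @[y --> x] --> (0 : A).
  by rewrite -(subrr x); apply: zmod_cvgB; [exact: cvg_cst|exact: cvg_id].
near=> y => h [h_morph hU]; apply: sub => /=.
have small_hom : forall k : {additive A -> circle R},
    (forall z, U z -> circle_norm (k z) <= 4^-1) ->
    circle_norm (k (x - y)) < e / 2.
  by near: y; exact: sub_cvg0 (additive_near0_small U0 e2).
have small_f : circle_norm (char_fun f (x - y)) < e / 2.
  by near: y; exact: sub_cvg0 (char_near0_small f e2).
pose ha : {additive A -> circle R} :=
  HB.pack h (GRing.isZmodMorphism.Build _ _ h h_morph).
rewrite ball_circleE /= -h_morph -(subrK (char_fun f (x - y)) (h _)).
apply: le_lt_trans (circle_normD _ _) _; rewrite [e]splitr ltrD //.
exact: (small_hom (ha \- char_fun f)).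
Unshelve. all: by end_near. Qed.

Lemma polar_hom_compact f U : nbhs 0 U ->
  compact (polar_hom f U : set {family compact, A -> circle R}).
Proof.
move=> U0; have equi := polar_hom_equicontinuous f U0.
have closure_polar :
    closure (polar_hom f U : set {family compact, A -> circle R})
    = polar_hom f U.
  rewrite pointwise_compact_closure // -(closure_id _).1 //.
  exact: polar_hom_closed.
rewrite -[X in compact X]closure_polar -precompactE.
apply: pointwise_precompact_equicontinuous => //.
  exact: (@metric_hausdorff R).
move=> x; apply: (@precompact_subset _ _ setT) => //.
by rewrite precompact_closed; [exact: circle_compact | exact: closedT].
Qed.

Lemma polar_compact f U : nbhs 0 U -> compact (polar f U).
Proof.
move=> U0; rewrite polarE compact_ultra => F FU FP.
have := @polar_hom_compact f U U0; rewrite compact_ultra.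
move=> /(_ (@char_fun R A @ F) (ultra_fmap _ FU) FP)[h [h_polar cvg_h]].
have h_cont : continuous h.
  exact: equicontinuous_continuous (polar_hom_equicontinuous f U0) h_polar.
have [g gh] := continuous_zmod_morphism_char h_cont h_polar.1.
by exists g; split; [rewrite /= gh | apply/dual_cvgP; rewrite gh].
Qed.

End Polars.

Section MetrizableSpaces.

Definition decreasing_nbhs_base (X : topologicalType) (p : X)
    (U : nat -> set X) :=
  [/\ U 0%N = setT,
      forall m n, (m <= n)%N -> U n `<=` U m,
      forall n, nbhs p (U n) &
      forall V, nbhs p V -> exists n, U n `<=` V].

Lemma metrizable_decreasing_nbhs_base (R : realType) (X : topologicalType)
    (p : X) : metrizable R X -> exists U, decreasing_nbhs_base p U.
Proof.
move=> [d [d_ge0 _ _ _ nbhs_d]].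
exists (fun n => [set x | n%:R * d p x < 1]); split.
- by apply/seteqP; split=> // x _; rewrite /= mul0r.
- by move=> m n mn x; apply: le_lt_trans; rewrite ler_wpM2r // ler_nat.
- case=> [|n]; apply/nbhs_d.
    by exists 1 => // x _; rewrite /= mul0r.
  exists n.+1%:R^-1; first by rewrite invr_gt0.
  by move=> x /=; rewrite -[n.+1%:R^-1]mul1r ltr_pdivlMr // mulrC.
move=> V /nbhs_d[e e0 ball_V].
have /archi_boundP : 0 <= e^-1 by rewrite invr_ge0 ltW.
set n := Num.bound _ => lt_n; exists n => x /= dx; apply: ball_V => /=.
rewrite -(ltr_pM2l (lt_trans _ lt_n)) ?invr_gt0 // (lt_trans dx) //.
by rewrite -ltr_pdivrMr // mul1r.
Qed.

End MetrizableSpaces.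

Lemma dependent_choice_bigcup (T : Type) (P Q : nat -> set T -> Prop) :
  P 0%N set0 -> (forall n S, P n S -> exists2 E, Q n E & P n.+1 (S `|` E)) ->
  exists E : nat -> set T, forall n, Q n (E n) /\ P n (\bigcup_(i < n) E i).
Proof.
move=> P0 step.
have /choice[next nextP] (p : nat * set T) :
    exists E, P p.1 p.2 -> Q p.1 E /\ P p.1.+1 (p.2 `|` E).
  have [/step[E QE PE]|nP] := pselect (P p.1 p.2); first by exists E.
  by exists set0.
pose S := fix S n := if n is m.+1 then S m `|` next (m, S m) else set0.
have PS n : P n (S n) by elim: n => // n /(nextP (n, S n))[].
exists (fun n => next (n, S n)) => n.
split; first by case: (nextP (n, S n) (PS n)).
suff -> : \bigcup_(i < n) next (i, S i) = S n by [].
rewrite bigcup_mkord; elim: n => [|n IHn]; first by rewrite big_ord0.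
by rewrite big_ord_recr IHn.
Qed.

Section BanachDieudonne.
Variables (R : realType) (A : topologicalZmodType).
Implicit Types (f : dual R A) (F : set (dual R A)) (S U V E : set A).

Lemma polar_finite_extension f F S U V : compactly_closed F -> nbhs 0 V ->
  polar f (S `|` U) `<=` ~` F ->
  exists2 E, finite_set E /\ E `<=` U & polar f (S `|` E `|` V) `<=` ~` F.
Proof.
move=> F_closed V0 SUF; have polar_SVc : compact (polar f (S `|` V)).
  by apply: polar_compact; apply: filterS V0 => x; right.
have := compact_cover_compact (compactly_closed_setI F_closed polar_SVc).
move=> /(_ _ U (fun x => ~` polar f [set x])).
case=> [x _|g [gSV Fg]|E EU cover_E].
- exact/closed_openC/polar_closed.
- apply: contrapT => not_covered; apply: SUF Fg; rewrite polarU.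
  split=> [x Sx|x Ux]; first by apply: gSV; left.
  apply: contrapT => gx; apply: not_covered; exists x => // /(_ x erefl).
  exact: gx.
exists [set` E]; first by split=> [|x /EU/set_mem]; first exact: finite_fset.
move=> g; rewrite setUAC polarU => -[gSV gE] Fg.
by have [x Ex] := cover_E g (conj gSV Fg); apply=> _ ->; exact: gE.
Qed.

Lemma compactly_closed_nbhs_setC f F (U : nat -> set A) :
  decreasing_nbhs_base 0 U -> compactly_closed F -> ~ F f -> nbhs f (~` F).
Proof.
move=> [U_setT U_decr U_nbhs U_base] F_closed nFf.
have [||E EP] := @dependent_choice_bigcup A
    (fun n S => polar f (S `|` U n) `<=` ~` F)
    (fun n E => finite_set E /\ E `<=` U n).
- by rewrite U_setT setUT polar_setT => _ ->.
- by move=> n S; exact: polar_finite_extension (U_nbhs n.+1).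
pose K := [set 0] `|` \bigcup_n E n.
have Kc : compact K.
  apply: (@finite_setD_nbhs_compact _ 0) => [|V V0]; first by left.
  have [n UnV] := U_base V V0.
  apply: (@sub_finite_set _ _ (\bigcup_(i < n) E i)); last first.
    by apply: bigcup_finite => [|i _]; [exact: finite_II | have [[]] := EP i].
  move=> x [[->|[i _ Eix]] nVx]; first by case: nVx; exact: nbhs_singleton.
  exists i => //; rewrite /= ltnNge; apply/negP => ni; apply: nVx.
  by have [[_ EU] _] := EP i; exact/UnV/(U_decr n i ni)/EU.
apply: filterS (polar_nbhs f Kc) => g gK.
have [V V0 gV] := char_in_polar_near0 f g; have [n UnV] := U_base V V0.
have [_] := EP n; apply; rewrite polarU; split=> x; last by move=> /UnV/gV.
by move=> [i _ Eix]; apply: gK; right; exists i.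
Qed.

End BanachDieudonne.

Theorem mainTheorem10 (R : realType) (A : topologicalZmodType) :
  metrizable R A -> k_space (dual R A).
Proof.
move=> metrA; split; first exact: dual_hausdorff.
move=> F F_closed; rewrite -openC openE => f nFf.
have [U U_base] := metrizable_decreasing_nbhs_base 0 metrA.
exact: compactly_closed_nbhs_setC U_base F_closed nFf.
Qed.
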